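(* On $S_u$ one has $\sigma=\tau$, and the map $\sigma:(S_u,\mathcal{T}_{S_u})\to(\mathbb{R},\mathcal{O}_n)$ is continuous.
   Context: $C$ is the set of all convex functions $f:\mathbb{R}\to\mathbb{R}$, endowed with the topology $\mathcal{T}$ of pointwise convergence (the smallest topology for which all evaluation maps $f\mapsto f(t)$, $t\in\mathbb{R}$, are continuous). $S_u=\{f\in C: f\text{ has a unique minimizing point}\}$, with subspace topology $\mathcal{T}_{S_u}=S_u\cap\mathcal{T}$. With $A(f)=\{t\in\mathbb{R}: f(t)=\inf_{s} f(s)\}$, $\sigma(f)=\min A(f)$ and $\tau(f)=\max A(f)$. $\mathcal{O}_n$ is the natural (Euclidean) topology on $\mathbb{R}$. *)

(* Defs.v *)
From mathcomp Require Import all_boot all_order all_algebra.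
From mathcomp Require Import all_classical all_reals all_analysis.

Set Implicit Arguments.
Unset Strict Implicit.
Unset Printing Implicit Defensive.

Import Order.TTheory GRing.Theory Num.Theory.
Import numFieldNormedType.Exports.

Local Open Scope classical_set_scope.
Local Open Scope ring_scope.

(* The carrier [{ptws R -> R}] is [R -> R] with the topology of pointwise
   convergence, so that [C R] and [Su R] can be used as subspaces of it. *)
Definition C (R : realType) : set {ptws R -> R} :=
  [set f | @convex_function R R^o setT f].
Arguments C R : clear implicits.

(* The infimum is taken in [\bar R]: the real-valued [inf] is 0 on sets that
   are not bounded below, whereas here [A f] is empty for such [f]. *)
Definition A (R : realType) (f : {ptws R -> R}) : set R :=
  [set t | (f t)%:E = ereal_inf [set (f s)%:E | s in [set: R]]].

(* Least and greatest elements; the value is 0 when there is none. *)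
Definition set_min (R : realType) (X : set R) : R := xget 0 (X `&` lbound X).
Definition set_max (R : realType) (X : set R) : R := xget 0 (X `&` ubound X).

Definition sigma (R : realType) (f : {ptws R -> R}) : R := set_min (A f).
Definition tau (R : realType) (f : {ptws R -> R}) : R := set_max (A f).

Definition Su (R : realType) : set {ptws R -> R} :=
  [set f | C R f /\ exists! t : R, A f t].
Arguments Su R : clear implicits.

(* Main.v *)
Require Import Defs.
From mathcomp Require Import all_boot all_order all_algebra.
From mathcomp Require Import all_classical all_reals all_analysis.
From mathcomp Require Import lra.
Import Order.TTheory GRing.Theory Num.Theory.
Import numFieldNormedType.Exports.
Local Open Scope classical_set_scope.
Local Open Scope ring_scope.

(** If [f] has the unique minimizer [t], then [f] is strictly larger at both
    [t - e] and [t + e] than at [t].  These are two strict inequalities between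
    values at three fixed points, so they persist for all [g] in a pointwise
    neighbourhood of [f].  When such a [g] is convex they trap its minimizers
    between [t - e] and [t + e] ([minimizer_trapped]): a minimizer beyond
    [t + e], say, would put [t + e] between two points where the value of [g]
    is at most [g t], against quasiconvexity ([convex_le_max]).  Hence
    [sigma g] is within [e] of [sigma f]. *)

Lemma minimizerP (R : realType) (f : {ptws R -> R}) (t : R) :
  A f t <-> forall s, f t <= f s.
Proof.
split=> [/= ft s|ft /=].
  by rewrite -lee_fin ft; apply: ereal_inf_lbound; exists s.
apply/eqP; rewrite eq_le; apply/andP; split.
  by apply: le_ereal_inf_tmp => _ [s _ <-]; rewrite lee_fin.
by apply: ereal_inf_lbound; exists t.
Qed.

Lemma set_min1 (R : realType) (t : R) : set_min [set t] = t.
Proof. by apply: xget_subset1 => [|x y [-> _] [-> _]//]; split=> // x ->. Qed.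

Lemma set_max1 (R : realType) (t : R) : set_max [set t] = t.
Proof. by apply: xget_subset1 => [|x y [-> _] [-> _]//]; split=> // x ->. Qed.

Lemma Su_minimizers (R : realType) (f : {ptws R -> R}) :
  Su R f -> A f = [set sigma f].
Proof.
move=> [_ [t [At tuniq]]].
have At1 : A f = [set t].
  by apply/seteqP; split=> s => [/tuniq ->|->].
by rewrite /sigma At1 set_min1.
Qed.

(** Quasiconvexity: a convex combination of two values is at most the larger. *)
Lemma convex_le_max (R : realType) (f : {ptws R -> R}) (a x b : R) :
  C R f -> a <= x <= b -> f x <= Num.max (f a) (f b).
Proof.
move=> Cf /andP[ax xb].
have [ab|ba] := ltP a b; last first.
  have -> : x = a by lra.
  by rewrite le_max lexx.
(* [x = p * a + (1 - p) * b] *)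
set p := (b - x) / (b - a).
have p0 : 0 <= p by rewrite divr_ge0 ?subr_ge0 // ltW.
have p1 : p <= 1 by rewrite ler_pdivrMr ?subr_gt0// mul1r lerB.
have pE : p * (b - a) = b - x by rewrite divfK// subr_eq0 gt_eqF.
have := Cf (Itv01 p0 p1) a b (in_setT _) (in_setT _).
rewrite [conv _ _ _ in X in X <= _](_ : _ = x); last first.
  by transitivity (p * a + (1 - p) * b); [exact: convRE|lra].
rewrite convRE /unstable.onem /=.
move=> /le_trans; apply.
set M := Num.max _ _.
have fa : f a <= M by rewrite le_max lexx.
have fb : f b <= M by rewrite le_max lexx orbT.
have -> : M = p * M + (1 - p) * M by lra.
by apply: lerD; apply: ler_wpM2l => //; rewrite subr_ge0.
Qed.

Lemma minimizer_trapped (R : realType) (g : {ptws R -> R}) (a t b s : R) :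
  C R g -> a < t < b -> g t < g a -> g t < g b -> A g s -> a < s < b.
Proof.
move=> Cg /andP[at_ tb] gta gtb /minimizerP/(_ t) gst.
apply/andP; split; rewrite ltNge; apply/negP => hs.
- have : g a <= Num.max (g s) (g t).
    by apply: convex_le_max => //; rewrite hs ltW.
  by rewrite (max_idPr gst) leNgt gta.
- have : g b <= Num.max (g t) (g s).
    by apply: convex_le_max => //; rewrite hs ltW.
  by rewrite (max_idPl gst) leNgt gtb.
Qed.

(** Evaluations are continuous for pointwise convergence, so a strict
    inequality between two values is an open condition. *)
Lemma near_ptws_lt (R : realType) (f : {ptws R -> R}) (a b : R) :
  f a < f b -> \forall g \near f, g a < g b.
Proof.
move=> fab.
have ev c : (fun g : {ptws R -> R} => g c) @ f --> f c.
  exact: (@proj_continuous R (fun=> R) c f).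
have /cvgr_gt : (fun g : {ptws R -> R} => g b - g a) @ f --> f b - f a.
  exact: (cvgB (ev b) (ev a)).
move=> /(_ 0); rewrite subr_gt0 => /(_ fab).
by apply: filterS => g /=; rewrite subr_gt0.
Qed.

Theorem corollary3 (R : realType) :
  (forall f : {ptws R -> R}, Su R f -> sigma f = tau f) /\
  {within Su R, continuous (@sigma R)}.
Proof.
split=> [f /Su_minimizers Af|].
  by rewrite /tau Af set_max1.
apply/subspace_continuousP => f Sf; set t := sigma f.
have Af := Su_minimizers _ _ Sf.
have ft s : s != t -> f t < f s.
  move=> /eqP st; rewrite ltNge; apply/negP => le_st.
  have /minimizerP At : A f t by rewrite Af.
  apply: st; suff : A f s by rewrite Af.
  by apply/minimizerP => u; apply: le_trans (At u).
apply/cvgrPdist_lt => e e0.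
have near_left : \forall g \near f, g t < g (t - e).
  by apply/near_ptws_lt/ft; rewrite lt_eqF//; lra.
have near_right : \forall g \near f, g t < g (t + e).
  by apply/near_ptws_lt/ft; rewrite gt_eqF//; lra.
rewrite near_withinE.
apply: filterS2 near_left near_right => g gl gr Sg.
have Ags : A g (sigma g) by rewrite (Su_minimizers _ _ Sg).
have tI : t - e < t < t + e by lra.
have := minimizer_trapped _ _ _ _ _ _ Sg.1 tI gl gr Ags.
by rewrite distrC ltr_distl.
Qed.
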